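(* For $n\ge 2$, define the homogeneous polynomial $$H_n(t,x_1,\dots,x_n)=(x_1-t)^4+(x_1-2x_2)^4+\sum_{i=2}^{n-1}(x_i^2-t\,x_{i+1})^2+4(x_1-t)^2x_n^2+2x_n^4 .$$ Then the subtraction-free complexity of $H_n$ is finite and is greater than $2^{n-2}$. By contrast, the ordinary arithmetic circuit complexity of $H_n$ is linear in $n$ (that is, $O(n)$).
   Context: An arithmetic circuit is a directed acyclic network whose gates each perform one binary arithmetic operation (addition, subtraction, multiplication or division); its inputs are the variables and arbitrary positive integer scalars, and it outputs a rational function in the variables. The size of a circuit is its number of gates. The ordinary arithmetic circuit complexity of a rational function is the smallest size of an arithmetic circuit computing it. The subtraction-free complexity of a rational function is the smallest size of a circuit computing it that uses only addition, multiplication and division gates; it is finite exactly when such a circuit exists. *)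

(* Defs.v *)
From HB Require Import structures.
From mathcomp Require Import all_boot all_order all_algebra.
From mathcomp Require Import mpoly.

Set Implicit Arguments.
Unset Strict Implicit.
Unset Printing Implicit Defensive.

Import GRing.Theory.
Local Open Scope ring_scope.

Definition ratfun (N : nat) := {fraction {mpoly rat[N]}}.

Definition ratfun_of_mpoly (N : nat) (p : {mpoly rat[N]}) : ratfun N :=
  tofrac p.

Inductive arith_op := Add | Sub | Mul | Div.

(* [Scalar k] stands for the positive integer [k]; [Scalar 0] has no value
   (see [source_val]).  [Gate j] is the output of the gate at position [j]. *)
Inductive source (N : nat) :=
  | Var of 'I_N
  | Scalar of nat
  | Gate of nat.

Record gate (N : nat) := MkGate {
  gate_op : arith_op;
  gate_left : source N;
  gate_right : source N
}.

(* The gates are listed in a topological order of the underlying directed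
   acyclic graph: a gate may only refer to gates at smaller positions. *)
Record circuit (N : nat) := MkCircuit {
  gates : seq (gate N);
  output : source N
}.

Definition circuit_size (N : nat) (c : circuit N) : nat := size (gates c).

Definition is_sub (o : arith_op) : bool := if o is Sub then true else false.

Definition subtraction_free (N : nat) (c : circuit N) : bool :=
  all (fun g => ~~ is_sub (gate_op g)) (gates c).

(* Division by the zero rational function is undefined. *)
Definition op_val (N : nat) (o : arith_op) (a b : ratfun N) :
    option (ratfun N) :=
  match o with
  | Add => Some (a + b)
  | Sub => Some (a - b)
  | Mul => Some (a * b)
  | Div => if b == 0 then None else Some (a / b)
  end.

(* [vals] lists the values of the gates evaluated so far, by position. *)
Definition source_val (N : nat) (vals : seq (ratfun N)) (u : source N) :
    option (ratfun N) :=
  match u with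
  | Var i => Some (ratfun_of_mpoly 'X_i)
  | Scalar k => if (0 < k)%N then Some k%:R else None
  | Gate j => onth vals j
  end.

Definition gate_val (N : nat) (vals : seq (ratfun N)) (g : gate N) :
    option (ratfun N) :=
  match source_val vals (gate_left g), source_val vals (gate_right g) with
  | Some a, Some b => op_val (gate_op g) a b
  | _, _ => None
  end.

Fixpoint gates_val (N : nat) (vals : seq (ratfun N)) (gs : seq (gate N)) :
    option (seq (ratfun N)) :=
  match gs with
  | [::] => Some vals
  | g :: gs' =>
      if gate_val vals g is Some a then gates_val (rcons vals a) gs' else None
  end.

Definition circuit_val (N : nat) (c : circuit N) : option (ratfun N) :=
  if gates_val [::] (gates c) is Some vals then source_val vals (output c)
  else None.

Definition computes (N : nat) (c : circuit N) (f : ratfun N) : Prop :=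
  circuit_val c = Some f.

(* A complexity is finite exactly when it is some natural number [s]; the
   number [s] is then unique. *)
Definition is_smallest_size (N : nat) (P : circuit N -> Prop) (s : nat) :
    Prop :=
  (exists2 c, P c & circuit_size c = s) /\
  (forall c, P c -> (s <= circuit_size c)%N).

Definition has_complexity (N : nat) (f : ratfun N) (s : nat) : Prop :=
  is_smallest_size (fun c => computes c f) s.

Definition has_sf_complexity (N : nat) (f : ratfun N) (s : nat) : Prop :=
  is_smallest_size (fun c => subtraction_free c /\ computes c f) s.

(* Among the [n.+1] variables, number [0] is [t] and number [i] is [x_i] for
   [1 <= i <= n]. *)
Definition H (n : nat) : {mpoly rat[n.+1]} :=
  let t : {mpoly rat[n.+1]} := 'X_ord0 in
  let x (i : nat) : {mpoly rat[n.+1]} := 'X_(inord i) in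
  (x 1%N - t) ^+ 4 + (x 1%N - 2%:R * x 2%N) ^+ 4
  + \sum_(2 <= i < n) (x i ^+ 2 - t * x i.+1) ^+ 2
  + 4%:R * (x 1%N - t) ^+ 2 * x n ^+ 2 + 2%:R * x n ^+ 4.

(* Main.v *)
(** Lower bound: a subtraction-free circuit of size [s] writes [H n] as [P / Q]
    where, after any specialisation to nonnegative polynomials of degree at most
    one in ['X], [P] and [Q] are nonzero with nonnegative coefficients and degree
    at most [2 ^ s].  Put [N = 2 ^ 2 ^ (n - 2)] and specialise along the line
    [t = N], [x_1 = 'X], [x_i = N / 2 ^ 2 ^ (i - 2)], on which [x_n = 1] and [H n]
    becomes [2 (('X - N)^2 + 1)^2].  Then [P] vanishes at [N + i], whose argument
    is less than [1 / N]; but the powers [(N + i) ^ k] with [0 < k <= N] all have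
    positive imaginary part, so [P] has degree greater than [N].

    Finiteness: let [S] be the set of rational functions computed by
    subtraction-free circuits, and divide [t] and the [x_i] by their sum, so that
    they add up to [1].  If [N +- a] lie in [S], then [a ^ 2 + e] lies in [S] for
    every rational [e > 0].  Hence the polynomials [a] in the variables for which
    for every [e > 0] some [C] satisfies [|a| <= e + C * H n] form a radical
    ideal.  It contains all the summands of [H n], then successively [x_n], ...,
    [x_2], [x_1], [t], then [1]; this bounds [H n] away from [0] and puts it
    in [S]. *)

Require Import Defs.
From HB Require Import structures.
From Stdlib Require Import Classical.
From mathcomp Require Import all_boot all_order all_algebra all_field.
From mathcomp Require Import mpoly.
From mathcomp Require Import ring lra zify.

Set Implicit Arguments.
Unset Strict Implicit.
Unset Printing Implicit Defensive.

(** * The polynomial [H] over an arbitrary commutative ring *)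

Section EvalH.
Import GRing.Theory.
Local Open Scope ring_scope.

Definition H_at (R : comPzRingType) (n : nat) (t : R) (x : nat -> R) : R :=
  (x 1%N - t) ^+ 4 + (x 1%N - 2%:R * x 2%N) ^+ 4
  + \sum_(2 <= i < n) (x i ^+ 2 - t * x i.+1) ^+ 2
  + 4%:R * (x 1%N - t) ^+ 2 * x n ^+ 2 + 2%:R * x n ^+ 4.

Lemma rmorph_H (R : comPzRingType) (n : nat) (f : {rmorphism {mpoly rat[n.+1]} -> R}) :
  f (H n) = H_at n (f 'X_ord0) (fun i => f 'X_(inord i)).
Proof.
have E i j k : f ('X_i - k%:R * 'X_j) = f 'X_i - k%:R * f 'X_j.
  by rewrite rmorphB rmorphM rmorph_nat.
have E1 i j : f ('X_i - 'X_j) = f 'X_i - f 'X_j by exact: rmorphB.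
rewrite /H /H_at 4!rmorphD rmorph_sum; congr (_ + _ + _ + _ + _).
- by rewrite rmorphXn E1.
- by rewrite rmorphXn E.
- by apply: eq_bigr => i _; rewrite !(rmorphXn, rmorphB, rmorphM).
- by rewrite 2!rmorphM rmorph_nat 2!rmorphXn E1.
- by rewrite rmorphM rmorph_nat rmorphXn.
Qed.

(** Homogeneity allows the variables to be divided by their sum. *)
Lemma H_atZ (R : comPzRingType) (n : nat) (s t : R) (x : nat -> R) :
  H_at n (s * t) (fun i => s * x i) = s ^+ 4 * H_at n t x.
Proof.
rewrite /H_at !mulrDr.
have -> : \sum_(2 <= i < n) ((s * x i) ^+ 2 - s * t * (s * x i.+1)) ^+ 2 =
          s ^+ 4 * \sum_(2 <= i < n) (x i ^+ 2 - t * x i.+1) ^+ 2.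
  by rewrite mulr_sumr; apply: eq_bigr => i _; ring.
by ring.
Qed.

End EvalH.

(** * Positivity relative to a set closed under addition, multiplication and division *)

Section Semifield.
Import GRing.Theory.
Local Open Scope ring_scope.

(** [S] stands for the rational functions with a subtraction-free circuit and serves as a strict
    positive cone. *)
Variables (K : fieldType) (S : K -> Prop).
Hypothesis S1 : S 1.
Hypothesis SD : forall a b, S a -> S b -> S (a + b).
Hypothesis SM : forall a b, S a -> S b -> S (a * b).
Hypothesis SV : forall a b, S a -> S b -> S (a / b).
Hypothesis S0 : ~ S 0.

Lemma S_neq0 a : S a -> a != 0.
Proof. by move=> Sa; apply/eqP => a0; apply: S0; rewrite -a0. Qed.

Lemma S_nat n : (0 < n)%N -> S n%:R.
Proof.
case: n => // n _; elim: n => // n IH.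
by rewrite -addn1 natrD; exact: SD.
Qed.

Lemma S_addnat a b n : S a -> S b -> S (a + n%:R * b).
Proof.
case: n => [|n] Sa Sb; first by rewrite mul0r addr0.
exact/SD/SM/Sb/S_nat.
Qed.

Lemma S_sum (I : Type) (r : seq I) (P : pred I) (F : I -> K) a :
  S a -> (forall i, P i -> S (F i)) -> S (a + \sum_(i <- r | P i) F i).
Proof.
move=> Sa SF; elim: r => [|i r IH]; first by rewrite big_nil addr0.
rewrite big_cons; case: ifP => // Pi.
by rewrite addrCA; apply: SD; first exact: SF.
Qed.

(** Main tool: denominators may be cleared by any member of [S] before an identity is sought. *)
Lemma S_divr a b : S b -> S (b * a) -> S a.
Proof.
move=> Sb Sba; rewrite -[a](mulKf (S_neq0 Sb)) mulrC.
exact: SV.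
Qed.

(* With [M = 2^(k+1)], the product of [M (A - B)^2 + 4 A B] and the positive
   [M (A^2 + B^2) + 2 (M - 2) A B] is, up to positive terms, the same form in
   [A^2, B^2] with [M] halved. *)
Lemma S_square_diff k A B : S A -> S B ->
  S ((2 ^ k)%:R * (A - B) ^+ 2 + 4%:R * A * B).
Proof.
elim: k A B => [|k IH] A B SA SB.
  have -> : (2 ^ 0)%:R * (A - B) ^+ 2 + 4%:R * A * B = (A + B) * (A + B) by ring.
  by apply: SM; exact: SD.
have [SA2 SB2] : S (A ^+ 2) /\ S (B ^+ 2) by rewrite !expr2; split; exact: SM.
have SAB := SM SA SB.
have [p Ep] : exists p, (2 ^ k)%N = p.+1.
  by exists (2 ^ k).-1; rewrite prednK // expn_gt0.
have Sp : S p.+1%:R by exact: S_nat.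
have {}IH : S (p.+1%:R * (A ^+ 2 - B ^+ 2) ^+ 2 + 4%:R * A ^+ 2 * B ^+ 2).
  by rewrite -Ep; exact: IH.
have E : (2 ^ k.+1)%:R = 2%:R * p.+1%:R :> K by rewrite expnS Ep natrM.
apply: (@S_divr _ (2%:R * p.+1%:R * (A ^+ 2 + B ^+ 2) + (4 * p)%:R * (A * B))).
  by apply: S_addnat => //; apply: SM; [apply: SM => //; exact: S_nat | exact: SD].
suff -> : (2%:R * p.+1%:R * (A ^+ 2 + B ^+ 2) + (4 * p)%:R * (A * B)) *
     ((2 ^ k.+1)%:R * (A - B) ^+ 2 + 4%:R * A * B) =
     4%:R * p.+1%:R *
       (p.+1%:R * (A ^+ 2 - B ^+ 2) ^+ 2 + 4%:R * A ^+ 2 * B ^+ 2)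
     + (16 * p)%:R * (A ^+ 2 * B ^+ 2).
  apply: S_addnat; last exact: SM.
  by do 2![apply: SM => //]; exact: S_nat.
by rewrite E !natrM -[p.+1]addn1 natrD; ring.
Qed.

(** Archimedean bound $-(N+1) < a < N+1$ in the order with positive cone [S]. *)
Definition bounded a := exists N, S (N.+1%:R + a) /\ S (N.+1%:R - a).

Lemma bounded1 : bounded 1.
Proof.
exists 1%N; split; first by apply: SD => //; exact: S_nat.
by have -> : 2%:R - 1 = 1 :> K by ring.
Qed.

Lemma boundedN a : bounded a -> bounded (- a).
Proof. by case=> N [Sp Sm]; exists N; rewrite opprK. Qed.

Lemma boundedD a b : bounded a -> bounded b -> bounded (a + b).
Proof.
case=> N [Sp Sm] [M [Tp Tm]]; exists (N.+1 + M)%N.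
have -> : (N.+1 + M).+1%:R = N.+1%:R + M.+1%:R :> K by rewrite -natrD addnS.
split; first by rewrite addrACA; exact: SD.
by rewrite opprD addrACA; exact: SD.
Qed.

Lemma boundedB a b : bounded a -> bounded b -> bounded (a - b).
Proof. by move=> Ba Bb; exact/boundedD/boundedN. Qed.

(** In the sums of products of $N+1 \pm a$ and $M+1 \pm b$ below, the terms linear in $a$ and in $b$
    cancel. *)
Lemma boundedM a b : bounded a -> bounded b -> bounded (a * b).
Proof.
case=> N [Sp Sm] [M [Tp Tm]]; exists (N * M + N + M)%N.
have -> : (N * M + N + M).+1%:R = N.+1%:R * M.+1%:R :> K.
  by rewrite -natrM; congr (_%:R); lia.
have S2 : S 2%:R by exact: S_nat.
split; apply: (S_divr S2).
  have -> : 2%:R * (N.+1%:R * M.+1%:R + a * b) =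
    (N.+1%:R + a) * (M.+1%:R + b) + (N.+1%:R - a) * (M.+1%:R - b) :> K by ring.
  by apply: SD; exact: SM.
have -> : 2%:R * (N.+1%:R * M.+1%:R - a * b) =
  (N.+1%:R + a) * (M.+1%:R - b) + (N.+1%:R - a) * (M.+1%:R + b) :> K by ring.
by apply: SD; exact: SM.
Qed.

Lemma boundedX a k : bounded a -> bounded (a ^+ k).
Proof.
move=> Ba; elim: k => [|k IH]; first exact: bounded1.
by rewrite exprS; exact: boundedM.
Qed.

(* In the preorder with positive cone [S], [f >= - 1 / m] for every [m > 0]. *)
Definition psd f := forall m : nat, S (f * m%:R + 1).

Lemma psd_S f : S f -> psd f.
Proof. by move=> Sf m; rewrite addrC mulrC; exact: S_addnat. Qed.

Lemma psd_divnat k f : psd (k.+1%:R * f) -> psd f.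
Proof.
move=> Pf m; apply: (S_divr (S_nat (ltn0Sn k))).
have -> : k.+1%:R * (f * m%:R + 1) = k.+1%:R * f * m%:R + 1 + k%:R * 1.
  by rewrite -[k.+1]addn1 natrD; ring.
exact: S_addnat.
Qed.

Lemma psdD f g : psd f -> psd g -> psd (f + g).
Proof.
move=> Pf Pg m; apply: (S_divr (S_nat (ltn0Sn 1))).
have -> : 2%:R * ((f + g) * m%:R + 1) =
  (f * (2 * m)%:R + 1) + (g * (2 * m)%:R + 1) by rewrite natrM; ring.
exact: SD.
Qed.

Lemma psd_sum (I : Type) (r : seq I) (P : pred I) (F : I -> K) :
  (forall i, P i -> psd (F i)) -> psd (\sum_(i <- r | P i) F i).
Proof.
move=> PF; elim/big_ind: _ => //; last exact: psdD.
by move=> m; rewrite mul0r add0r.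
Qed.

Lemma psdM_S s f : S s -> bounded s -> psd f -> psd (s * f).
Proof.
move=> Ss [N [_ Sm]] Pf m; apply: (S_divr (S_nat (ltn0Sn N))).
have -> : N.+1%:R * (s * f * m%:R + 1) =
  s * (f * (N.+1 * m)%:R + 1) + (N.+1%:R - s) by rewrite natrM; ring.
by apply: SD => //; exact: SM.
Qed.

Lemma psd_nat k f : psd f -> psd (k%:R * f).
Proof.
move=> Pf m; have -> : k%:R * f * m%:R = f * (k * m)%:R by rewrite natrM; ring.
exact: Pf.
Qed.

(** For $A, B = N+1 \pm a$ the form of [S_square_diff] equals $4((2^k-1)a^2 + (N+1)^2)$. Division by
    $4(2^k-1)$ leaves the error $(N+1)^2/(2^k-1)$, at most $1/m$ for $k = m(N+1)^2$. *)
Lemma psd_sqr a : bounded a -> psd (a ^+ 2).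
Proof.
case=> N [Sp Sm] m.
(* [p] is the slack in $2^k - 1 \ge k$. *)
have [p Ep] : exists p, (2 ^ (m * N.+1 ^ 2))%N = (m * N.+1 ^ 2 + p).+1.
  exists (2 ^ (m * N.+1 ^ 2) - (m * N.+1 ^ 2).+1)%N.
  by have := ltn_expl (m * N.+1 ^ 2) (ltnSn 1); lia.
have := S_square_diff (m * N.+1 ^ 2) Sp Sm; rewrite Ep => Sq.
(* At $m = 0$ the divisor $2^k - 1$ would be zero. *)
case: m => [|m] in p Ep Sq *; first by rewrite mulr0 add0r.
apply: (S_divr (S_nat (ltn0Sn (m.+1 * N.+1 ^ 2 + p - 1)))).
apply: (S_divr (S_nat (isT : 0 < 4)%N)); apply: (S_divr (S_nat (ltn0Sn N))).
apply: (S_divr (S_nat (ltn0Sn N))).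
set q := (m.+1 * N.+1 ^ 2 + p - 1).+1.
have Eq : q = (m.+1 * N.+1 ^ 2 + p)%N by rewrite /q; lia.
rewrite -Eq in Sq.
suff -> : N.+1%:R * (N.+1%:R * (4%:R * (q%:R * (a ^+ 2 * m.+1%:R + 1)))) =
  (m.+1 * N.+1 ^ 2)%:R *
   (q.+1%:R * (N.+1%:R + a - (N.+1%:R - a)) ^+ 2
      + 4%:R * (N.+1%:R + a) * (N.+1%:R - a))
  + p%:R * (4%:R * (N.+1%:R ^+ 2)).
  apply: S_addnat; first by apply: SM => //; apply: S_nat; lia.
  by apply: SM; [exact: S_nat | rewrite -natrX; apply: S_nat; lia].
rewrite -[q.+1]addn1 Eq !(natrM, natrD, natrX).
by ring.
Qed.

(** * The radical ideal of elements vanishing with [h] *)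

Section Vanishing.
Variable h : K.
Hypothesis psd_h : psd h.

(* [a] vanishes wherever the nonnegative function [h] does. *)
Definition vanish a := forall m : nat, exists C : nat,
  psd (C%:R * h + 1 - m%:R * a) /\ psd (C%:R * h + 1 + m%:R * a).

Lemma vanish_le a : psd a -> psd (h - a) -> vanish a.
Proof.
move=> Pa Pha m; exists m; split.
  have -> : m%:R * h + 1 - m%:R * a = m%:R * (h - a) + 1 by ring.
  by apply: psdD; [exact: psd_nat | exact: psd_S].
by do ![apply: psdD]; [exact: psd_nat | exact: psd_S | exact: psd_nat].
Qed.

Lemma vanishN a : vanish a -> vanish (- a).
Proof.
by move=> Va m; have [C [P Q]] := Va m; exists C; rewrite mulrN opprK.
Qed.

Lemma vanishD a b : vanish a -> vanish b -> vanish (a + b).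
Proof.
move=> Va Vb m; have [C [P Q]] := Va (2 * m)%N; have [D [P' Q']] := Vb (2 * m)%N.
exists (C + D)%N; split; apply: (@psd_divnat 1).
  have -> : 2%:R * ((C + D)%:R * h + 1 - m%:R * (a + b)) =
    (C%:R * h + 1 - (2 * m)%:R * a) + (D%:R * h + 1 - (2 * m)%:R * b)
    + (C + D)%:R * h by rewrite !(natrM, natrD); ring.
  by do ![apply: psdD => //]; exact: psd_nat.
have -> : 2%:R * ((C + D)%:R * h + 1 + m%:R * (a + b)) =
  (C%:R * h + 1 + (2 * m)%:R * a) + (D%:R * h + 1 + (2 * m)%:R * b)
  + (C + D)%:R * h by rewrite !(natrM, natrD); ring.
by do ![apply: psdD => //]; exact: psd_nat.
Qed.

(** The two bounds on [a] are mixed with the weights $N+1 \pm p$ in [S]; these add up to $2(N+1)$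
    and differ by $2p$, which produces the term in $pa$. *)
Lemma vanishM p a : bounded p -> vanish a -> vanish (p * a).
Proof.
move=> Bp Va m; case: (Bp) => N [Sp Sm]; have [C [P Q]] := Va (N.+1 * m)%N.
have BN : bounded N.+1%:R.
  elim: N {Sp Sm P Q} => [|N IH]; first exact: bounded1.
  by rewrite -[N.+2]addn1 natrD; exact/boundedD/bounded1.
have [Bs Bd] : bounded (N.+1%:R + p) /\ bounded (N.+1%:R - p).
  by split; [exact: boundedD | exact: boundedB].
exists C; split; apply: (@psd_divnat 1); apply: (@psd_divnat N).
  have -> : N.+1%:R * (2%:R * (C%:R * h + 1 - m%:R * (p * a))) =
    (N.+1%:R + p) * (C%:R * h + 1 - (N.+1 * m)%:R * a) +
    (N.+1%:R - p) * (C%:R * h + 1 + (N.+1 * m)%:R * a).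
    by rewrite natrM; ring.
  by apply: psdD; exact: psdM_S.
have -> : N.+1%:R * (2%:R * (C%:R * h + 1 + m%:R * (p * a))) =
  (N.+1%:R - p) * (C%:R * h + 1 - (N.+1 * m)%:R * a) +
  (N.+1%:R + p) * (C%:R * h + 1 + (N.+1 * m)%:R * a).
  by rewrite natrM; ring.
by apply: psdD; exact: psdM_S.
Qed.

(** Here $2m|a| \le 1 + m^2a^2$, the difference being the square $(1 \mp ma)^2$. *)
Lemma vanish_sqr a : bounded a -> vanish (a ^+ 2) -> vanish a.
Proof.
move=> Ba Va m; have [C [P _]] := Va (m ^ 2)%N.
have Bm : bounded (m%:R * a).
  elim: m {P} => [|m IH]; first by rewrite mul0r -(subrr 1); exact/boundedB/bounded1/bounded1.
  by rewrite -[m.+1]addn1 natrD mulrDl mul1r; exact: boundedD.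
exists C; split; apply: (@psd_divnat 1).
  have -> : 2%:R * (C%:R * h + 1 - m%:R * a) =
    C%:R * h + 1 - (m ^ 2)%:R * a ^+ 2 + (1 - m%:R * a) ^+ 2 + C%:R * h.
    by rewrite natrX; ring.
  by do ![apply: psdD => //]; [apply/psd_sqr/boundedB => //; exact: bounded1 | exact: psd_nat].
have -> : 2%:R * (C%:R * h + 1 + m%:R * a) =
  C%:R * h + 1 - (m ^ 2)%:R * a ^+ 2 + (1 + m%:R * a) ^+ 2 + C%:R * h.
  by rewrite natrX; ring.
by do ![apply: psdD => //]; [apply/psd_sqr/boundedD => //; exact: bounded1 | exact: psd_nat].
Qed.

Lemma vanish_sum (I : Type) (r : seq I) (P : pred I) (F : I -> K) :
  (forall i, P i -> vanish (F i)) -> vanish (\sum_(i <- r | P i) F i).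
Proof.
move=> VF; elim/big_ind: _ => //; last exact: vanishD.
by move=> m; exists 0%N; rewrite mul0r mulr0 add0r subr0 addr0; split; exact: psd_S.
Qed.

(** With $m = 2$ the hypothesis says $Ch \ge 1$ up to any error; the error $1/2$ puts $2Ch - 1$,
    hence $2Ch$, in [S], and $C \ne 0$ because $0$ is not in [S]. *)
Lemma S_of_vanish1 : vanish 1 -> S h.
Proof.
move=> /(_ 2%N) [C [P _]]; have := P 2%N.
have -> : (C%:R * h + 1 - 2%:R * 1) * 2%:R + 1 = (2 * C)%:R * h - 1.
  by rewrite natrM; ring.
move=> /(SD S1); rewrite addrC subrK; case: C {P} => [|C].
  by rewrite muln0 mul0r => /S0.
by apply: S_divr; apply: S_nat; lia.
Qed.

End Vanishing.

Lemma S_H_at (n : nat) (t : K) (x : nat -> K) : (2 <= n)%N ->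
  S t -> (forall i, S (x i)) -> S (H_at n t x).
Proof.
move=> n2 St Sx.
(* Normalising the sum only removes a factor $s^4$, which lies in [S]. *)
wlog sum1 : t x St Sx / t + \sum_(1 <= i < n.+1) x i = 1.
  move=> hwlog; set s := t + \sum_(1 <= i < n.+1) x i.
  have Ss : S s by exact: S_sum.
  have s0 := S_neq0 Ss.
  have -> : H_at n t x = H_at n (s * (t / s)) (fun i => s * (x i / s)).
    by rewrite /H_at; rewrite ![s * (_ / s)]mulrC !divfK //;
       congr (_ + _ + _ + _ + _); apply: eq_bigr => i _; rewrite ![s * (_ / s)]mulrC !divfK.
  rewrite H_atZ; apply: SM; first by rewrite !exprS expr0 mulr1; do ![apply: SM => //].
  apply: hwlog; [exact: SV | by move=> i; exact: SV |].
  by rewrite -mulr_suml -mulrDl divff.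
(* Now $1$ minus a variable is the sum of the others, so it lies in [S]. *)
have Bt : bounded t.
  exists 0%N; split; first exact: SD.
  have -> : 1%:R - t = \sum_(1 <= i < n.+1) x i by rewrite -sum1 addrAC subrr add0r.
  by rewrite big_nat_recr ?(ltnW n2) //= addrC; exact: S_sum.
have Bx i : (1 <= i <= n)%N -> bounded (x i).
  move=> Hi; exists 0%N; split; first exact: SD.
  have iI : i \in index_iota 1 n.+1 by rewrite mem_index_iota ltnS.
  have -> : 1%:R - x i = t + \sum_(j <- index_iota 1 n.+1 | j != i) x j.
    by rewrite -sum1 (bigD1_seq i) ?iota_uniq //= addrCA [x i + _]addrC addrK.
  exact: S_sum.
set h := H_at n t x.
have sq a : bounded a -> psd (a ^+ 2) by exact: psd_sqr.
have q4 a : bounded a -> psd (a ^+ 4).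
  by move=> Ba; rewrite -[4%N]/(2 * 2)%N exprM; exact/psd_sqr/boundedX.
have [B1 [B2 Bn]] : bounded (x 1%N) /\ bounded (x 2%N) /\ bounded (x n).
  by do !split; apply: Bx; lia.
have Bu : bounded (x 1%N - t) by exact: boundedB.
have Bv : bounded (x 1%N - 2%:R * x 2%N).
  by apply: boundedB => //; apply: boundedM => //; exact/boundedD/bounded1/bounded1.
have Bw i : (2 <= i < n)%N -> bounded (x i ^+ 2 - t * x i.+1).
  by move=> Hi; apply: boundedB; [apply/boundedX/Bx | apply/boundedM/Bx => //]; lia.
have P1 := q4 _ Bu; have P2 := q4 _ Bv.
have P3 : psd (\sum_(2 <= i < n) (x i ^+ 2 - t * x i.+1) ^+ 2).
  by rewrite big_nat_cond; apply: psd_sum => i /andP[Hi _]; exact/sq/Bw.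
have P4 : psd (4%:R * (x 1%N - t) ^+ 2 * x n ^+ 2).
  by rewrite -mulrA -exprMn; exact/psd_nat/sq/boundedM.
have P5 : psd (x n ^+ 4) by exact: q4.
have P6 : psd (2%:R * x n ^+ 4) by exact: psd_nat.
have Ph : psd h by rewrite /h /H_at; do ![apply: psdD => //].
pose V := vanish h.
have V4 a : bounded a -> V (a ^+ 4) -> V a.
  move=> Ba; rewrite -[4%N]/(2 * 2)%N exprM => /(vanish_sqr Ph (boundedX 2 Ba)).
  exact: vanish_sqr.
have V_le a r : psd a -> psd r -> h = a + r -> V a.
  by move=> Pa Pr E; apply: vanish_le => //; rewrite E addrAC subrr add0r.
(* Each summand and its complement in [h] are nonnegative, so the summand lies in the ideal, and so
   does its base. *)
have Vu : V (x 1%N - t).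
  apply: V4 => //; apply: (V_le _ ((x 1%N - 2%:R * x 2%N) ^+ 4
    + \sum_(2 <= i < n) (x i ^+ 2 - t * x i.+1) ^+ 2
    + 4%:R * (x 1%N - t) ^+ 2 * x n ^+ 2 + 2%:R * x n ^+ 4)) => //.
    by do ![apply: psdD => //].
  by rewrite /h /H_at !addrA.
have Vv : V (x 1%N - 2%:R * x 2%N).
  apply: V4 => //; apply: (V_le _ ((x 1%N - t) ^+ 4
    + \sum_(2 <= i < n) (x i ^+ 2 - t * x i.+1) ^+ 2
    + 4%:R * (x 1%N - t) ^+ 2 * x n ^+ 2 + 2%:R * x n ^+ 4)) => //.
    by do ![apply: psdD => //].
  by rewrite /h /H_at; ring.
have Vn : V (x n).
  apply: V4 => //; apply: (V_le _ ((x 1%N - t) ^+ 4 + (x 1%N - 2%:R * x 2%N) ^+ 4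
    + \sum_(2 <= i < n) (x i ^+ 2 - t * x i.+1) ^+ 2
    + 4%:R * (x 1%N - t) ^+ 2 * x n ^+ 2 + x n ^+ 4)) => //.
    by do ![apply: psdD => //].
  by rewrite /h /H_at; ring.
have Vw i : (2 <= i < n)%N -> V (x i ^+ 2 - t * x i.+1).
  move=> Hi; apply: vanish_sqr => //; first exact: Bw.
  have iI : i \in index_iota 2 n by rewrite mem_index_iota.
  apply: (V_le _ ((x 1%N - t) ^+ 4 + (x 1%N - 2%:R * x 2%N) ^+ 4
    + \sum_(j <- index_iota 2 n | j != i) (x j ^+ 2 - t * x j.+1) ^+ 2
    + 4%:R * (x 1%N - t) ^+ 2 * x n ^+ 2 + 2%:R * x n ^+ 4)).
  - exact/sq/Bw.
  - do ![apply: psdD => //]; rewrite big_seq_cond; apply: psd_sum => j /andP[].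
    by rewrite mem_index_iota => Hj _; exact/sq/Bw.
  by rewrite /h /H_at (bigD1_seq i) ?iota_uniq //=; ring.
(* Descent from $x_n$ to $x_2$: $x_i^2 = (x_i^2 - t x_{i+1}) + t x_{i+1}$ is in the ideal, which is
   radical. *)
have Vx k : (k <= n - 2)%N -> V (x (n - k)%N).
  elim: k => [|k IH] Hk; first by rewrite subn0.
  have E : (n - k.+1).+1 = (n - k)%N by lia.
  apply: vanish_sqr => //; first by apply: Bx; lia.
  rewrite -[x _ ^+ 2](subrK (t * x (n - k)%N)).
  apply: vanishD => //; last by apply: vanishM => //; apply: IH; lia.
  by rewrite -E; apply: Vw; lia.
have Vx2 : V (x 2%N).
  have -> : 2%N = (n - (n - 2))%N by lia.
  exact: Vx.
have Vx1 : V (x 1%N).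
  rewrite -(subrK (2%:R * x 2%N) (x 1%N)); apply: vanishD => //.
  by rewrite mulr_natl mulr2n; exact: vanishD.
have Vt : V t by rewrite -(subKr (x 1%N) t); apply: vanishD => //; exact: vanishN.
apply: S_of_vanish1; rewrite -sum1; apply: vanishD => //.
rewrite big_nat_cond; apply: vanish_sum => // i /andP[Hi _].
have [->|i1] := eqVneq i 1%N; first exact: Vx1.
by have -> : i = (n - (n - i))%N; [lia | apply: Vx; lia].
Qed.

End Semifield.

(** * Building circuits and counting their gates *)

Section Circuits.
Import Order.TTheory GRing.Theory Num.Theory.
Local Open Scope ring_scope.

Variable N : nat.

Lemma gates_val_cat (vals : seq (ratfun N)) gs1 gs2 :
  gates_val vals (gs1 ++ gs2) =
  if gates_val vals gs1 is Some vals1 then gates_val vals1 gs2 else None.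
Proof.
elim: gs1 vals => //= g gs1 IH vals.
by case: (gate_val vals g) => // a; exact: IH.
Qed.

Lemma source_val_cat (vals vs : seq (ratfun N)) u f :
  source_val vals u = Some f -> source_val (vals ++ vs) u = Some f.
Proof.
case: u => //= j Ej; rewrite onth_cat ifT //.
by rewrite -onthTE Ej.
Qed.

(** [true] admits subtraction gates and [false] forbids them, so that the same lemmas serve both
    complexities. *)
Variable sub : bool.

(* Quantifying over the values [vals] already present lets circuits be
   concatenated without renumbering gates. *)
Definition computable (k : nat) (f : ratfun N) := forall vals,
  exists gs vs u, [/\ all (fun g => sub || ~~ is_sub (gate_op g)) gs,
    (size gs <= k)%N, gates_val vals gs = Some (vals ++ vs) &
    source_val (vals ++ vs) u = Some f].

Lemma computable_circuit k f : computable k f ->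
  exists c, [/\ sub || subtraction_free c, computes c f & (circuit_size c <= k)%N].
Proof.
case/(_ [::]) => gs [vs] [u] [Hs Hk Hg Hu]; exists (MkCircuit gs u); split=> //.
  by case: sub Hs.
by rewrite /computes /circuit_val /= Hg.
Qed.

Lemma computable_leq k l f : (k <= l)%N -> computable k f -> computable l f.
Proof.
move=> kl Cf vals; have [gs [vs] [u] [Hs Hk Hg Hu]] := Cf vals.
by exists gs, vs, u; split=> //; exact: leq_trans kl.
Qed.

Lemma computable_source u f : (forall vals, source_val vals u = Some f) ->
  computable 0 f.
Proof. by move=> Hu vals; exists [::], [::], u; rewrite cats0. Qed.

Lemma computable_var i : computable 0 (ratfun_of_mpoly 'X_i).
Proof. exact: (@computable_source (Var i)). Qed.

Lemma computable_nat n : computable 0 n.+1%:R.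
Proof. exact: (@computable_source (Scalar N n.+1)). Qed.

(** The second circuit runs after the first and a last gate reads both outputs; nothing is shared,
    so sizes add. *)
Lemma computable_op o k l a b f : sub || ~~ is_sub o ->
  op_val o a b = Some f -> computable k a -> computable l b ->
  computable (k + l).+1 f.
Proof.
move=> Ho Eo Ca Cb vals; have [gs [vs] [u] [Hs Hk Hg Hu]] := Ca vals.
have [gs' [vs'] [u'] [Hs' Hk' Hg' Hu']] := Cb (vals ++ vs).
exists ((gs ++ gs') ++ [:: MkGate o u u']), ((vs ++ vs') ++ [:: f]).
exists (Gate N (size (vals ++ vs ++ vs'))); split.
- by rewrite !all_cat Hs Hs' /= Ho.
- by rewrite !size_cat addn1 ltnS leq_add.
- rewrite !gates_val_cat Hg Hg' /= /gate_val /= Hu' (source_val_cat _ Hu) Eo.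
  by rewrite -cats1 !catA.
by rewrite /= catA onth_cat ltnn subnn.
Qed.

Lemma computableD k l a b : computable k a -> computable l b ->
  computable (k + l).+1 (a + b).
Proof. by apply: (@computable_op Add) => //; rewrite orbT. Qed.

Lemma computableM k l a b : computable k a -> computable l b ->
  computable (k + l).+1 (a * b).
Proof. by apply: (@computable_op Mul) => //; rewrite orbT. Qed.

Lemma computableV k l a b : b != 0 -> computable k a -> computable l b ->
  computable (k + l).+1 (a / b).
Proof.
move=> /negbTE b0; apply: (@computable_op Div); first by rewrite orbT.
by rewrite /= b0.
Qed.

Lemma computableB k l a b : sub -> computable k a -> computable l b ->
  computable (k + l).+1 (a - b).
Proof. by move=> Hs; apply: (@computable_op Defs.Sub) => //; rewrite Hs. Qed.

Lemma computableX e k a : computable k a -> computable (e.+1 * k.+1) (a ^+ e.+1).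
Proof.
move=> Ca; elim: e => [|e IH].
  by apply: computable_leq Ca; rewrite mul1n.
rewrite exprS; apply: computable_leq (computableM Ca IH).
by rewrite [in X in (_ <= X)%N]mulSn.
Qed.

Lemma computable_sum (I : Type) (r : seq I) (F : I -> ratfun N) k l a :
  computable k a -> (forall i, computable l (F i)) ->
  computable (k + l.+1 * size r) (a + \sum_(i <- r) F i).
Proof.
move=> Ca CF; elim: r a k Ca => [|i r IH] a k Ca.
  by rewrite big_nil addr0 muln0 addn0.
rewrite big_cons addrA mulnS addnA addnS.
by apply: IH; exact: computableD.
Qed.

End Circuits.

(** * Degree growth in subtraction-free circuits *)

Section DegreeBound.
Import Order.TTheory GRing.Theory Num.Theory.
Local Open Scope ring_scope.

Definition nonneg_poly (p : {poly rat}) := p != 0 /\ forall i, 0 <= p`_i.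

(** The leading coefficient of [p] is positive and no coefficient of [q] can cancel it. *)
Lemma nonneg_polyD p q : nonneg_poly p -> nonneg_poly q -> nonneg_poly (p + q).
Proof.
move=> [p0 Hp] [q0 Hq]; split; last by move=> i; rewrite coefD addr_ge0.
have: 0 < (p + q)`_(size p).-1.
  rewrite coefD ltr_pwDl // lt_def Hp andbT.
  by rewrite -lead_coefE lead_coef_eq0.
by apply: contraTneq => ->; rewrite coef0 ltxx.
Qed.

Lemma nonneg_polyM p q : nonneg_poly p -> nonneg_poly q -> nonneg_poly (p * q).
Proof.
move=> [p0 Hp] [q0 Hq]; split; first by rewrite mulf_neq0.
by move=> i; rewrite coefM sumr_ge0 // => j _; rewrite mulr_ge0.
Qed.

Lemma nonneg_polyC c : 0 < c -> nonneg_poly c%:P.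
Proof.
move=> c0; split; first by rewrite polyC_eq0 gt_eqF.
by move=> i; rewrite coefC; case: ifP => // _; exact: ltW.
Qed.

Lemma nonneg_polyX : nonneg_poly 'X.
Proof. by split=> [|i]; rewrite ?polyX_eq0 // coefX ler0n. Qed.

Variables (N : nat) (phi : {rmorphism {mpoly rat[N]} -> {poly rat}}).
Hypothesis phi_nonneg : forall i, nonneg_poly (phi 'X_i).
Hypothesis phi_size : forall i, (size (phi 'X_i) <= 2)%N.

(** As [phi] is defined on polynomials only, numerator and denominator are kept unspecialised and
    conditions are put on their images. *)
Definition nonneg_ratio (d : nat) (f : ratfun N) :=
  exists P Q, [/\ f * tofrac Q = tofrac P,
    nonneg_poly (phi P), nonneg_poly (phi Q),
    (size (phi P) <= d.+1)%N & (size (phi Q) <= d.+1)%N].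

Lemma phi_neq0 P : nonneg_poly (phi P) -> tofrac P != 0.
Proof.
by case=> nz _; rewrite tofrac_eq0; apply: contraNneq nz => ->; rewrite rmorph0.
Qed.

Lemma nonneg_ratio_leq d e f : (d <= e)%N -> nonneg_ratio d f -> nonneg_ratio e f.
Proof.
move=> de [P [Q [E HP HQ sP sQ]]]; exists P, Q; split=> //.
  exact: leq_trans sP _.
exact: leq_trans sQ _.
Qed.

Lemma nonneg_ratio_neq0 d f : nonneg_ratio d f -> f != 0.
Proof.
move=> [P [Q [E HP HQ _ _]]]; apply: contraTneq (phi_neq0 HP) => f0.
by rewrite -E f0 mul0r eqxx.
Qed.

Lemma size_mul_deg (p q : {poly rat}) d e : (size p <= d.+1)%N -> (size q <= e.+1)%N ->
  (size (p * q)%R <= (d + e).+1)%N.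
Proof. by move=> Hp Hq; apply: leq_trans (size_polyMleq _ _) _; lia. Qed.

Lemma ratio_add (K : fieldType) (a b q q' : K) :
  (a + b) * (q * q') = a * q * q' + b * q' * q.
Proof. by ring. Qed.

Lemma ratio_div (K : fieldType) (a b q q' : K) : b != 0 ->
  a / b * (q * (b * q')) = a * q * q'.
Proof. by move=> b0; field. Qed.

Lemma nonneg_ratio_op o d e a b f : ~~ is_sub o -> op_val o a b = Some f ->
  nonneg_ratio d a -> nonneg_ratio e b -> nonneg_ratio (d + e) f.
Proof.
move=> Ho Eo [P [Q [E HP HQ sP sQ]]] [P' [Q' [E' HP' HQ' sP' sQ']]].
have [P0 Q0] := (phi_neq0 HP', phi_neq0 HQ').
case: o Ho Eo => //= _.
- case=> <-; exists (P * Q' + P' * Q), (Q * Q'); split.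
  + by rewrite tofracD !tofracM -E -E' ratio_add.
  + by rewrite rmorphD !rmorphM; apply: nonneg_polyD; exact: nonneg_polyM.
  + by rewrite rmorphM; exact: nonneg_polyM.
  + rewrite rmorphD !rmorphM; apply: leq_trans (size_polyD _ _) _.
    by rewrite geq_max size_mul_deg // addnC size_mul_deg.
  by rewrite rmorphM size_mul_deg.
- case=> <-; exists (P * P'), (Q * Q'); split; rewrite ?(rmorphM phi).
  + by rewrite !tofracM -E -E' mulrACA.
  + exact: nonneg_polyM.
  + exact: nonneg_polyM.
  + exact: size_mul_deg.
  exact: size_mul_deg.
have [//|b0 [<-]] := eqVneq b 0; exists (P * Q'), (Q * P'); split; rewrite ?(rmorphM phi).
+ by rewrite !tofracM -E -E' ratio_div.
+ exact: nonneg_polyM.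
+ exact: nonneg_polyM.
+ exact: size_mul_deg.
exact: size_mul_deg.
Qed.

(** A gate adds the degrees of its two inputs, so the bound doubles with each gate. *)
Definition all_nonneg_ratio (vals : seq (ratfun N)) := forall j f,
  onth vals j = Some f -> nonneg_ratio (2 ^ size vals) f.

Lemma nonneg_ratio_source vals u f : all_nonneg_ratio vals ->
  source_val vals u = Some f -> nonneg_ratio (2 ^ size vals) f.
Proof.
move=> Hv; have pos := expn_gt0 2 (size vals).
have one : nonneg_poly 1 by rewrite -polyC1; exact: nonneg_polyC.
case: u => [i|[|k]|j] //=; last exact: Hv.
- case=> <-; exists 'X_i, 1; rewrite !rmorph1 mulr1; split=> //.
    by apply: leq_trans (phi_size i) _.
  by rewrite size_poly1.
case=> <-; exists k.+1%:R, 1; rewrite !rmorph1 mulr1 !rmorph_nat -polyC_natr.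
split=> //; first by apply: nonneg_polyC; rewrite ltr0n.
  by apply: leq_trans (size_polyC_leq1 _) _.
by rewrite size_poly1.
Qed.

Lemma nonneg_ratio_gates vals gs vals' : 
  all (fun g => ~~ is_sub (gate_op g)) gs -> all_nonneg_ratio vals ->
  gates_val vals gs = Some vals' ->
  all_nonneg_ratio vals' /\ size vals' = (size vals + size gs)%N.
Proof.
elim: gs vals => [|g gs IH] vals /=; first by move=> _ Hv [<-]; rewrite addn0.
case/andP=> Hg Hgs Hv; rewrite /gate_val.
case Ea: source_val => [a|//]; case Eb: source_val => [b|//].
case Ef: op_val => [f|//] => Egs.
rewrite addnS -addSn -(size_rcons vals f); apply: IH Egs => // j f'.
rewrite size_rcons expnS mul2n -addnn -cats1 onth_cat.
case: ifP => _; first by move=> /Hv; apply: nonneg_ratio_leq; exact: leq_addr.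
case/onth1P => _ <-.
exact: nonneg_ratio_op Hg Ef (nonneg_ratio_source Hv Ea) (nonneg_ratio_source Hv Eb).
Qed.

Lemma nonneg_ratio_circuit c f : subtraction_free c -> computes c f ->
  nonneg_ratio (2 ^ circuit_size c) f.
Proof.
rewrite /computes /circuit_val => Hc; case Eg: gates_val => [vals|//].
have [|Hv Es] := nonneg_ratio_gates Hc _ Eg; first by move=> j f'; rewrite onth0n.
by move=> /(nonneg_ratio_source Hv); rewrite Es add0n.
Qed.

End DegreeBound.

(** * A complex root of small argument forces a large degree *)

Section ComplexRoot.
Import Order.TTheory GRing.Theory Num.Theory.
Local Open Scope ring_scope.

Variable M : nat.
Hypothesis M_gt0 : (0 < M)%N.

(** Real and imaginary parts of $(M+i)^k$, kept rational so that order arguments stay in [rat]. *)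
Fixpoint re_im_pow (k : nat) : rat * rat :=
  if k is k'.+1 then
    (M%:R * (re_im_pow k').1 - (re_im_pow k').2,
     M%:R * (re_im_pow k').2 + (re_im_pow k').1)
  else (1, 0).

Lemma re_im_powE k : (M%:R + 'i) ^+ k =
  ratr (re_im_pow k).1 + 'i * ratr (re_im_pow k).2 :> algC.
Proof.
elim: k => [|k IH]; first by rewrite expr0 /= rmorph1 rmorph0 mulr0 addr0.
rewrite exprS IH /= rmorphB rmorphD !rmorphM rmorph_nat.
set a := ratr _; set b := ratr _.
have -> : (M%:R + 'i) * (a + 'i * b) = M%:R * a + 'i ^+ 2 * b + 'i * (M%:R * b + a) :> algC
  by ring.
by rewrite sqrCi mulN1r.
Qed.

(* The second clause says [tan (k theta) <= k / (M - k)] for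
   [theta = arctan (1 / M)]. *)
Lemma re_im_pow_bound k : (k < M)%N -> [/\ 0 < (re_im_pow k).1,
  (re_im_pow k).2 * (M%:R - k%:R) <= k%:R * (re_im_pow k).1 & 0 <= (re_im_pow k).2].
Proof.
elim: k => [|k IH] kM /=; first by rewrite mul0r mul0r.
have [] := IH (ltnW kM); move: (re_im_pow k).1 (re_im_pow k).2 => a b a0 ab b0.
have k0 : 0 <= k%:R :> rat by rewrite ler0n.
have kM' : k%:R + 2 <= M%:R :> rat by rewrite -natrD ler_nat; lia.
rewrite -[k.+1]addn1 natrD.
move: k0 kM' ab; move: (k%:R : rat) (M%:R : rat) => x m x0 xm ab.
have P : 0 < m * a - b by nra.
split=> //; last by nra.
(* The goal is multiplied by $m - x > 0$ so that the induction hypothesis $b(m-x) \le xa$ can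
   eliminate $b$ on both sides. *)
have : (m * b + a) * (m - (x + 1)) * (m - x) <= (x + 1) * (m * a - b) * (m - x).
  have E1 : (m * b + a) * (m - (x + 1)) * (m - x) <=
            (m * x + (m - x)) * a * (m - (x + 1)).
    have : 0 <= (m * (m - (x + 1))) * (x * a - b * (m - x)).
      by rewrite mulr_ge0 ?subr_ge0 // mulr_ge0 //; lra.
    by lra.
  have E2 : (x + 1) * (m * (m - x) - x) * a <= (x + 1) * (m * a - b) * (m - x).
    have : 0 <= (x + 1) * (x * a - b * (m - x)).
      by rewrite mulr_ge0 ?subr_ge0 //; lra.
    by lra.
  apply: le_trans E1 (le_trans _ E2).
  have : 0 <= ((m - x - 2) * (2 * x + 1) + 3 * x + 2) * a.
    have : 0 <= (m - x - 2) * (2 * x + 1) by rewrite mulr_ge0 //; lra.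
    by move=> ?; rewrite mulr_ge0 //; lra.
  by lra.
by rewrite ler_pM2r // subr_gt0; nra.
Qed.

(** The next imaginary part is $Mb + a$ with $a > 0$ and $b \ge 0$, so the exponent $M$ itself is
    reached. *)
Lemma im_pow_gt0 k : (0 < k <= M)%N -> 0 < (re_im_pow k).2.
Proof.
case: k => // k kM; have [a0 _ b0] := re_im_pow_bound kM.
by rewrite /= ltr_wpDl // mulr_ge0.
Qed.

(** If $\deg p \le M$, the imaginary part of $p(M+i) = 0$ has only nonnegative terms, which kills
    $p_k$ for $0 < k \le M$; the real part then kills $p_0$. *)
Lemma size_nonneg_poly_root (p q : {poly rat}) : nonneg_poly p ->
  p = (('X - M%:R) ^+ 2 + 1) * q -> (M.+1 < size p)%N.
Proof.
move=> [p0 pp] Ep; rewrite ltnNge; apply: contra p0 => sp.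
have : (map_poly ratr p).[M%:R + 'i] = 0 :> algC.
  rewrite Ep rmorphM hornerM rmorphD rmorphXn rmorphB /= map_polyX rmorph1 rmorph_nat.
  by rewrite !hornerE -polyC_natr hornerC addrAC subrr add0r sqrCi addNr mul0r.
rewrite (horner_coef_wide _ (n := M.+1)); last by rewrite size_map_poly.
rewrite (eq_bigr (fun i : 'I_M.+1 => ratr (p`_i * (re_im_pow i).1) +
    'i * ratr (p`_i * (re_im_pow i).2))); last first.
  by move=> i _; rewrite coef_map /= re_im_powE mulrDr (mulrCA _ 'i) !(rmorphM ratr).
rewrite big_split /= -mulr_sumr -!rmorph_sum => E0.
have realr (r : rat) : (ratr r : algC) \is Num.real by exact: rpred_rat.
have /(congr1 (fun z : algC => 'Im z)) := E0; rewrite /= Im_rect // raddf0 => /eqP.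
rewrite fmorph_eq0 => /eqP I0.
have /(congr1 (fun z : algC => 'Re z)) := E0; rewrite /= Re_rect // raddf0 => /eqP.
rewrite fmorph_eq0 => /eqP R0.
have pi i : (0 < i <= M)%N -> p`_i = 0.
  move=> Hi; have Hi' : (i < M.+1)%N by lia.
  move: I0; move/eqP; rewrite psumr_eq0; last first.
    move=> j _; rewrite mulr_ge0 //.
    by have [->|j0] := eqVneq (j : nat) 0%N; [| apply/ltW/im_pow_gt0; have := ltn_ord j; lia].
  move=> /allP /(_ (Ordinal Hi')); rewrite mem_index_enum /= => /(_ isT).
  by rewrite mulf_eq0 => /orP[/eqP //|]; rewrite gt_eqF // im_pow_gt0.
rewrite big_ord_recl /= mulr1 big1 in R0; last first.
  by move=> j _; rewrite pi ?mul0r // /bump /=; have := ltn_ord j; lia.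
apply/eqP/polyP => i; rewrite coef0.
have [->|i0] := eqVneq i 0%N; first by rewrite -[LHS]addr0.
have [iM|Mi] := leqP i M; first by apply: pi; lia.
by rewrite nth_default //; exact: leq_trans sp Mi.
Qed.

End ComplexRoot.

(** * Specialisation to a line and the exponential lower bound *)

Section LowerBound.
Import Order.TTheory GRing.Theory Num.Theory.
Local Open Scope ring_scope.

(** The constants solve $2x_2 = t$ and $x_i^2 = t x_{i+1}$; the exponent of $2$ in the denominator
    doubles until $x_n = 1$. *)
Definition line_point (n i : nat) : {poly rat} :=
  let N := 2%:R ^+ (2 ^ (n - 2)) in
  if i is i'.+1 then
    if i' is i''.+1 then (N / 2%:R ^+ (2 ^ i''))%:P else 'X
  else N%:P.

Definition line_eval (n : nat) : {mpoly rat[n.+1]} -> {poly rat} :=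
  mmap polyC (fun i : 'I_n.+1 => line_point n i).

HB.instance Definition _ n := GRing.RMorphism.on (@line_eval n).

Lemma line_evalX n (i : 'I_n.+1) : line_eval 'X_i = line_point n i.
Proof. by rewrite /line_eval mmapX mmap1U. Qed.

(** With $u = X - N$, the first two terms give $2u^4$, the sum is zero, and $x_n = 1$ turns the rest
    into $4u^2 + 2$. *)
Lemma line_eval_H n : (2 <= n)%N ->
  line_eval (H n) = (('X - (2 ^ 2 ^ (n - 2))%:R) ^+ 2 + 1) *
    (2%:R * (('X - (2 ^ 2 ^ (n - 2))%:R) ^+ 2 + 1)).
Proof.
move=> n2; rewrite rmorph_H /H_at /= !line_evalX.
rewrite (eq_big_nat _ _ (F2 := fun i =>
  (line_point n i ^+ 2 - line_point n 0 * line_point n i.+1) ^+ 2)); last first.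
  by move=> i Hi; rewrite !line_evalX !inordK //; lia.
rewrite !inordK //; [|lia].
set N := (2 ^ 2 ^ (n - 2))%N.
have EN : 2%:R ^+ (2 ^ (n - 2)) = N%:R :> rat by rewrite -natrX.
have E0 : line_point n 0 = N%:R by rewrite /= EN polyC_natr.
have E2 : 2%:R * line_point n 2 = N%:R.
  by rewrite /= EN expn0 expr1 -polyC_natr -polyCM mulrC divfK // polyC_natr.
have En : line_point n n = 1.
  case: n n2 @N EN E0 E2 => [|[|k]] //= _ _ _ _.
  by rewrite subn2 /= divff // expf_neq0.
rewrite En big_nat_cond big1 => [|i /andP[/andP[i2 iin] _]].
  by rewrite -[line_point n 1]/'X E0 E2; ring.
case: i i2 iin => [|[|i]] // _ _; rewrite [X in X ^+ 2](_ : _ = 0) ?expr0n //.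
apply/eqP; rewrite subr_eq0; apply/eqP.
rewrite /line_point -polyC_exp -polyCM; congr (_%:P).
rewrite expnS mulnC exprM; field.
by rewrite expf_neq0.
Qed.

Lemma line_point_nonneg n i : nonneg_poly (line_point n i).
Proof.
case: i => [|[|i]] /=; first by apply: nonneg_polyC; rewrite exprn_gt0.
  exact: nonneg_polyX.
by apply: nonneg_polyC; rewrite divr_gt0 // exprn_gt0.
Qed.

Lemma size_line_point n i : (size (line_point n i) <= 2)%N.
Proof.
case: i => [|[|i]] /=; rewrite ?size_polyX //;
by apply: leq_trans (size_polyC_leq1 _) _.
Qed.

Lemma computes_nonneg_ratio n (c : circuit n.+1) f : subtraction_free c ->
  computes c f -> nonneg_ratio (@line_eval n) (2 ^ circuit_size c) f.
Proof.
by apply: nonneg_ratio_circuit => i /=; rewrite line_evalX;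
  [exact: line_point_nonneg | exact: size_line_point].
Qed.

(** The image of $P = HQ$ inherits the factor $(X-N)^2 + 1$, so its degree exceeds $2^{2^{n-2}}$,
    while it is at most $2^s$ for a circuit of size $s$. *)
Lemma sf_circuit_size n c : (2 <= n)%N -> subtraction_free c ->
  computes c (ratfun_of_mpoly (H n)) -> (2 ^ (n - 2) < circuit_size c)%N.
Proof.
move=> n2 Hc Hv.
have [P [Q [E HP _ sP _]]] := computes_nonneg_ratio Hc Hv.
move: E; rewrite /ratfun_of_mpoly -tofracM => /eqP; rewrite tofrac_eq => /eqP E.
have M_gt0 : (0 < 2 ^ 2 ^ (n - 2))%N by rewrite expn_gt0.
have : ((2 ^ 2 ^ (n - 2)).+1 < size (line_eval P))%N.
  apply: (size_nonneg_poly_root M_gt0 HP).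
  by rewrite -E rmorphM /= line_eval_H // -mulrA; reflexivity.
by move=> /leq_trans /(_ sP); rewrite ltnS ltn_exp2l.
Qed.

(** This supplies the condition that $0$ is not in [S], and makes division legal. *)
Lemma computable_neq0 n k (f : ratfun n.+1) : computable false k f -> f != 0.
Proof.
case/computable_circuit => c [Hc Hv _].
exact: nonneg_ratio_neq0 (computes_nonneg_ratio Hc Hv).
Qed.

End LowerBound.

(** * Finiteness and the linear upper bound *)

Section UpperBounds.
Import GRing.Theory.
Local Open Scope ring_scope.

Lemma ratfun_H n : ratfun_of_mpoly (H n) = H_at n (ratfun_of_mpoly 'X_ord0)
  (fun i => ratfun_of_mpoly ('X_(inord i) : {mpoly rat[n.+1]})).
Proof. exact: rmorph_H. Qed.

Lemma sf_circuit_H n : (2 <= n)%N -> exists c,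
  subtraction_free c /\ computes c (ratfun_of_mpoly (H n)).
Proof.
move=> n2; pose S (f : ratfun n.+1) := exists k, computable false k f.
suff [k /computable_circuit [c [Hc Hv _]]] : S (ratfun_of_mpoly (H n)).
  by exists c.
rewrite ratfun_H; apply: S_H_at n2 _ _.
- by exists 0%N; rewrite -(mulr1n 1); exact: computable_nat.
- by move=> a b [k Ca] [l Cb]; exists (k + l).+1; exact: computableD.
- by move=> a b [k Ca] [l Cb]; exists (k + l).+1; exact: computableM.
- move=> a b [k Ca] [l Cb]; exists (k + l).+1; apply: computableV => //.
  exact: computable_neq0 Cb.
- by case=> k /computable_neq0; rewrite eqxx.
- by exists 0%N; exact: computable_var.
by move=> i; exists 0%N; exact: computable_var.
Qed.

(** Each summand takes a bounded number of gates and the sum has $n - 2$ terms; [100] is a generous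
    constant. *)
Lemma circuit_H n : (2 <= n)%N -> exists c,
  computes c (ratfun_of_mpoly (H n)) /\ (circuit_size c <= 100 * n)%N.
Proof.
move=> n2; suff C : computable true (100 * n) (ratfun_of_mpoly (H n)).
  by have [c [_ Hv Hs]] := computable_circuit C; exists c.
rewrite ratfun_H /H_at.
have B k l a b := @computableB n.+1 true k l a b isT.
have D k l a b := @computableD n.+1 true k l a b.
have Mu k l a b := @computableM n.+1 true k l a b.
have X e k a := @computableX n.+1 true e k a.
have V (i : 'I_n.+1) := computable_var true i.
have k2 := computable_nat (N := n.+1) true 1; have k4 := computable_nat (N := n.+1) true 3.
have U := B _ _ _ _ (V (inord 1)) (V ord0).
have W := B _ _ _ _ (V (inord 1)) (Mu _ _ _ _ k2 (V (inord 2))).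
have Q i := X 1%N _ _ (B _ _ _ _ (X 1%N _ _ (V (inord i)))
                          (Mu _ _ _ _ (V ord0) (V (inord i.+1)))).
have S1 := D _ _ _ _ (X 3%N _ _ U) (X 3%N _ _ W).
have S2 := computable_sum (index_iota 2 n) S1 Q.
have S3 := D _ _ _ _ S2
  (Mu _ _ _ _ (Mu _ _ _ _ k4 (X 1%N _ _ U)) (X 1%N _ _ (V (inord n)))).
have S4 := D _ _ _ _ S3 (Mu _ _ _ _ k2 (X 3%N _ _ (V (inord n)))).
apply: computable_leq S4; rewrite size_iota; lia.
Qed.

End UpperBounds.

(** Descent on the size; as [P] is an arbitrary proposition, excluded middle decides whether a
    smaller circuit exists. *)
Lemma smallest_size (N : nat) (P : circuit N -> Prop) (c : circuit N) : P c ->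
  exists s, is_smallest_size P s.
Proof.
move=> Pc; have [k] := ubnP (circuit_size c).
elim: k c Pc => // k IH c Pc; rewrite ltnS => ck.
have [[c' [Pc' lt]]|min] := classic (exists c', P c' /\ circuit_size c' < circuit_size c).
  exact: (IH c') (leq_trans lt ck).
exists (circuit_size c); split; first by exists c.
by move=> c' Pc'; rewrite leqNgt; apply/negP => lt; apply: min; exists c'.
Qed.

Theorem proposition8p4 :
  (forall n : nat, 2 <= n ->
     exists s : nat,
       has_sf_complexity (ratfun_of_mpoly (H n)) s /\ 2 ^ (n - 2) < s) /\
  (exists C : nat, forall n : nat, 2 <= n ->
     exists s : nat,
       has_complexity (ratfun_of_mpoly (H n)) s /\ s <= C * n).
Proof.
split=> [n n2|].
  have [c Hc] := sf_circuit_H n2.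
  have [s Hs] : exists s, has_sf_complexity (ratfun_of_mpoly (H n)) s.
    exact: (smallest_size (c := c)).
  exists s; split=> //; case: Hs => [[c' [Hc' Hv] <-] _].
  exact: sf_circuit_size.
exists 100 => n n2; have [c [Hc sc]] := circuit_H n2.
have [s Hs] : exists s, has_complexity (ratfun_of_mpoly (H n)) s.
  exact: (smallest_size (c := c)).
exists s; split=> //.
by apply: leq_trans sc; case: Hs => _; exact.
Qed.
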